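(* Let $p\ge 2$ and let $P_0=N_p(\mathbf 0,I)$ be the standard normal distribution on $\mathbb{R}^p$. The asymptotic breakdown point $\varepsilon^{*}=\min(\varepsilon_E^{*},\varepsilon_I^{*})$ of the deepest scatter matrix estimator $\hat\Gamma$ (known location $\mathbf 0$) is equal to $1/3$.
   Context: $\mathcal{S}^{p-1}$ is the unit sphere of $\mathbb{R}^p$; $\mathcal{E}$ is the set of symmetric positive definite $p\times p$ real matrices. For a probability $P$ on $\mathbb{R}^p$, $\mathbf X\sim P$ and $\Gamma\in\mathcal{E}$, the scatter depth (known location $\mathbf 0$) is $$D_S(\Gamma,P)=\inf_{\mathbf u\in\mathcal{S}^{p-1}}\min\{P(|\mathbf u^t\mathbf X|^2\le \mathbf u^t\Gamma\mathbf u),\,P(|\mathbf u^t\mathbf X|^2\ge \mathbf u^t\Gamma\mathbf u)\}.$$ A deepest scatter matrix $\hat\Gamma(P)$ is any maximizer of $D_S(\cdot,P)$ over $\mathcal{E}$ (it need not be unique; suprema of bias below are taken over all deepest matrices). At $P_0$ it is $\hat\Gamma(P_0)=\beta I$ with $\beta=\{\Phi^{-1}(3/4)\}^2$, where $\Phi$ is the standard normal distribution function. The $\varepsilon$-contamination neighborhood is $\mathcal{P}_\varepsilon(P_0)=\{(1-\varepsilon)P_0+\varepsilon G: G \text{ any distribution on }\mathbb{R}^p\}$, $\varepsilon\in[0,1)$. The explosion and implosion biases are $$b_E(\hat\Gamma,\varepsilon,P)=\sup_{\mathbf u\in\mathcal{S}^{p-1}}\frac{\mathbf u^t\hat\Gamma(P)\mathbf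 u}{\mathbf u^t\hat\Gamma(P_0)\mathbf u},\qquad b_I(\hat\Gamma,\varepsilon,P)=\sup_{\mathbf u\in\mathcal{S}^{p-1}}\frac{\mathbf u^t\hat\Gamma(P)^{-1}\mathbf u}{\mathbf u^t\hat\Gamma(P_0)^{-1}\mathbf u},$$ with maximum biases $B_E(\hat\Gamma,\varepsilon,P_0)=\sup_{P\in\mathcal{P}_\varepsilon(P_0)} b_E(\hat\Gamma,\varepsilon,P)$ and $B_I(\hat\Gamma,\varepsilon,P_0)=\sup_{P\in\mathcal{P}_\varepsilon(P_0)} b_I(\hat\Gamma,\varepsilon,P)$. The breakdown points are $\varepsilon_E^{*}=\inf\{\varepsilon>0:B_E(\hat\Gamma,\varepsilon,P_0)=\infty\}$ and $\varepsilon_I^{*}=\inf\{\varepsilon>0:B_I(\hat\Gamma,\varepsilon,P_0)=\infty\}$. *)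

(* Defs.v *)
From HB Require Import structures.
From mathcomp Require Import all_boot all_order all_algebra.
From mathcomp Require Import all_classical all_reals all_analysis.

Set Implicit Arguments.
Unset Strict Implicit.
Unset Printing Implicit Defensive.

Import Order.TTheory GRing.Theory Num.Theory.
Import numFieldNormedType.Exports.

Local Open Scope classical_set_scope.
Local Open Scope ring_scope.

(* Points of R^p at which probabilities live: p-tuples with the product of the
   Borel sigma-algebras, i.e. the Borel sigma-algebra of R^p. Directions are
   column vectors. *)
Notation Rn R p := (p.-tuple (measurableTypeR R)).

Section std_normal.
Context {R : realType}.

Definition Rcons n (z : measurableTypeR R * Rn R n) : Rn R n.+1 :=
  [the n.+1.-tuple _ of z.1 :: z.2].

Lemma measurable_Rcons n : measurable_fun [set: _] (@Rcons n).
Proof. exact: measurable_cons. Qed.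

HB.instance Definition _ n :=
  @isMeasurableFun.Build _ _ _ _ (@Rcons n) (@measurable_Rcons n).

(* N_n(0, I): the law of n independent N(0, 1) coordinates. *)
Fixpoint std_normal n : probability (Rn R n) R :=
  if n is n'.+1 then
    distribution (normal_prob (0 : R) 1 \x std_normal n')%E (@Rcons n')
  else \d_([tuple] : Rn R 0).

Lemma std_normal_box n (A : 'I_n -> set (measurableTypeR R)) :
  (forall i, measurable (A i)) ->
  std_normal n [set x | forall i, A i (tnth x i)] =
  (\prod_(i < n) normal_prob (0 : R) 1 (A i))%E.
Proof.
elim: n A => [|n IHn] A mA.
  by rewrite big_ord0 /= diracE mem_set//; case.
pose B := [set x : Rn R n | forall i, A (lift ord0 i) (tnth x i)].
have mB : measurable B.
  have -> : B = \bigcap_(i in [set: 'I_n]) (@tnth n _ ^~ i @^-1` A (lift ord0 i)).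
    by apply/seteqP; split => [x xA i _|x xA i]; [exact: xA|exact: (xA i)].
  apply: fin_bigcap_measurable => // i _.
  by rewrite -[X in measurable X]setTI; exact: measurable_tnth.
rewrite big_ord_recl -IHn// -/B.
rewrite -(product_measure1E (normal_prob 0 1) (std_normal n) (mA ord0) mB).
rewrite /= /distribution /pushforward.
congr (_ _); apply/seteqP; split => -[a x] /=.
  move=> H; split; first exact: (H ord0).
  by move=> i; have := H (lift ord0 i); rewrite tnthS.
move=> -[Aa Ax] i; case: (unliftP ord0 i) => [j ->|->//].
by rewrite tnthS; exact: Ax.
Qed.

End std_normal.

Section scatter.
Context {R : realType} {p : nat}.
Implicit Types (u : 'cV[R]_p) (x : Rn R p) (G : 'M[R]_p).
Implicit Types (P Q : probability (Rn R p) R) (e : R).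

Definition sphere : set 'cV[R]_p := [set u | \sum_i u i 0 ^+ 2 = 1].

Definition dotp u x : R := \sum_i u i 0 * tnth x i.

Definition qform G u : R := (u^T *m G *m u) 0 0.

Definition spd G : Prop :=
  G^T = G /\ forall u, u != 0 -> 0 < qform G u.

Definition scatter_depth G P : \bar R :=
  ereal_inf [set mine (P [set x | `|dotp u x| ^+ 2 <= qform G u])
                      (P [set x | `|dotp u x| ^+ 2 >= qform G u])
            | u in sphere].

Definition deepest P G : Prop :=
  spd G /\ forall G', spd G' -> (scatter_depth G' P <= scatter_depth G P)%E.

Definition contamination e P0 P : Prop :=
  exists Q : probability (Rn R p) R, forall A, measurable A ->
    P A = ((1 - e)%:E * P0 A + e%:E * Q A)%E.

Definition explosion_bias G G0 : \bar R :=
  ereal_sup [set (qform G u / qform G0 u)%:E | u in sphere].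

Definition implosion_bias G G0 : \bar R :=
  ereal_sup [set (qform (invmx G) u / qform (invmx G0) u)%:E | u in sphere].

(* Deepest matrices need not be unique, so the supremum also ranges over all of
   them: G at the contaminated P, G0 at P0. A P without deepest matrix
   contributes nothing. *)
Definition max_bias (b : 'M[R]_p -> 'M[R]_p -> \bar R) e P0 : \bar R :=
  ereal_sup [set y | exists P G G0,
    [/\ contamination e P0 P, deepest P G, deepest P0 G0 & y = b G G0]].

Definition breakdown_point b P0 : \bar R :=
  ereal_inf [set e%:E | e in [set e | 0 < e < 1 /\ max_bias b e P0 = +oo%E]].

End scatter.

(* Main.v *)
Require Import Defs.
From HB Require Import structures.
From mathcomp Require Import all_boot all_order all_algebra.
From mathcomp Require Import all_classical all_reals all_analysis.
From mathcomp Require Import measurable_realfun.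
From mathcomp Require Import ring lra.

Set Implicit Arguments.
Unset Strict Implicit.
Unset Printing Implicit Defensive.

Import Order.TTheory GRing.Theory Num.Theory.
Import numFieldNormedType.Exports.

Local Open Scope classical_set_scope.
Local Open Scope ring_scope.

(** Let [F] be the law of [`|Z|] for a standard normal [Z], [b] its median, and
    [beta = b ^ 2]. Every projection of N(0, I) on a unit vector has the law
    of [Z] ([std_normal_dotp]), so the depth of [G] at a contaminated law only
    depends on how the slab [(u, x)^2 <= u^t G u] splits [F] and the
    contaminating law.

    Lower bound. Whatever the contamination, [beta I] keeps depth at least
    [(1 - e) / 2], because a fraction [1 - e] of the mass is split evenly in
    every direction. If a deepest [G] had [u^t G u] huge (or tiny) for some unit
    [u], its depth would be at most about [e], the contaminated mass being the
    only one left outside (inside) the slab. For [e < 1/3] this is smaller than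
    [(1 - e) / 2]; so [u^t G u] stays in a compact subset of the positive reals
    that depends on [e] only ([deepest_qform_bounds]), hence so does
    [u^t G^-1 u] ([qform_invmx_bounds]). The case [e = 0] controls the deepest
    matrices at N(0, I) itself.

    Upper bound. Put all the contamination on the single point [a = b e_1],
    where the matrix [a a^t], of rank one, has the atom exactly on the boundary
    of all its slabs. Then
    - no positive definite matrix has depth above [(1 - e) / 2]
      ([dirac_depth_le]): in some direction, or in the limit along a family of
      directions, the atom falls on the less favourable side;
    - for [e = 1/3] all the matrices [(1 - t) beta I + t a a^t] with
      [0 <= t < 1] reach that value ([flattened_depth_ge]): the atom lies inside
      all their slabs, and these slabs carry at most half of the mass of
      N(0, I).
    So all of them are deepest at the same contaminated law, and as [t] tends
    to 1 they become singular in every direction orthogonal to [a]: the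
    implosion bias is already infinite at [e = 1/3]. *)

(** * Normal laws under affine maps and convolution *)

Section normal_law.
Context {R : realType}.
Notation mu := (@lebesgue_measure R).

Definition affine (a c : R) : measurableTypeR R -> measurableTypeR R :=
  fun z => a * z + c.

Lemma measurable_affine a c : measurable_fun [set: _] (affine a c).
Proof. exact: measurable_funD. Qed.

HB.instance Definition _ a c :=
  @isMeasurableFun.Build _ _ _ _ (affine a c) (measurable_affine a c).

(** For [a != 0] this is the Lebesgue measure itself, by change of variables. *)
Definition lebesgue_affine (a c : R) :
  {measure set (measurableTypeR R) -> \bar R}.
Proof.
refine (mscale (NngNum (normr_ge0 a)) (pushforward mu (affine a c))).
exact: measurable_affine.
Defined.

Lemma lebesgue_affineE a c A :
  lebesgue_affine a c A = (`|a|%:E * mu (affine a c @^-1` A))%E.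
Proof. by []. Qed.

(** Both sides agree on intervals, which determine the measure; a negative [a]
    turns left-open intervals into right-open ones. *)
Lemma lebesgue_measure_affine (a c : R) (A : set R) : a != 0 -> measurable A ->
  mu A = (`|a|%:E * mu (affine a c @^-1` A))%E.
Proof.
move=> a0 mA.
rewrite (@lebesgue_measure_unique _ (lebesgue_affine a c))// => _ [[x y]] _ <-.
rewrite lebesgue_affineE lebesgue_measure_itv/= lte_fin.
have := a0; rewrite neq_lt => /orP[an|ap].
- rewrite [X in mu X](_ : _ = `[(y - c) / a, (x - c) / a[%classic); last first.
    apply/seteqP; split => z /=; rewrite !in_itv/= /affine => /andP[h1 h2].
      by rewrite ler_ndivrMr// ltr_ndivlMr//; apply/andP; split; lra.
    move: h1 h2; rewrite ler_ndivrMr// ltr_ndivlMr// => h1 h2.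
    by apply/andP; split; lra.
  rewrite lebesgue_measure_itv/= lte_fin ltr_ndivlMr// divfK// ltrD2r.
  case: ifP => _; last by rewrite mule0.
  by rewrite -EFinB -EFinM (ltr0_norm an); congr EFin; field.
- rewrite [X in mu X](_ : _ = `](x - c) / a, (y - c) / a]%classic); last first.
    apply/seteqP; split => z /=; rewrite !in_itv/= /affine => /andP[h1 h2].
      by rewrite ler_pdivlMr// ltr_pdivrMr//; apply/andP; split; lra.
    move: h1 h2; rewrite ler_pdivlMr// ltr_pdivrMr// => h1 h2.
    by apply/andP; split; lra.
  rewrite lebesgue_measure_itv/= lte_fin ltr_pdivlMr// divfK ?gt_eqF// ltrD2r.
  case: ifP => _; last by rewrite mule0.
  by rewrite -EFinB -EFinM (gtr0_norm ap); congr EFin; field.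
Qed.

Lemma normal_pdf_affine (a c z : R) : a != 0 ->
  `|a| * normal_pdf c a (affine a c z) = normal_pdf 0 1 z.
Proof.
move=> a0; rewrite !normal_pdfE// ?oner_neq0// /normal_peak /normal_fun /affine.
rewrite -mulrnAr sqrtrM ?sqr_ge0// sqrtr_sqr invfM !mulrA mulfV ?normr_eq0// mul1r.
rewrite expr1n mul1r; congr (_ * expR _).
by field.
Qed.

Lemma normal_prob_affine (a c : R) (A : set R) : a != 0 -> measurable A ->
  normal_prob 0 1 (affine a c @^-1` A) = normal_prob c a A.
Proof.
move=> a0 mA; rewrite /normal_prob.
have mpdf D : measurable_fun D (fun x => (normal_pdf c a x)%:E).
  by apply/measurable_funTS/measurable_EFinP; exact: measurable_normal_pdf.
have pdf_ge0 x : (0 <= (normal_pdf c a x)%:E)%E by rewrite lee_fin normal_pdf_ge0.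
rewrite [RHS](@eq_measure_integral _ _ _ _ (lebesgue_affine a c)); last first.
  by move=> B mB _; exact: lebesgue_measure_affine.
rewrite ge0_integral_mscale//.
rewrite (ge0_integral_pushforward (measurable_affine a c))//.
rewrite -ge0_integralZl//=.
- by apply: eq_integral => z _ /=; rewrite -EFinM normal_pdf_affine.
- by rewrite -[X in _.-measurable X]setTI; exact: measurable_affine.
- by apply: measurable_funTS; exact: (measurableT_comp (mpdf setT) (measurable_affine a c)).
- exact: mpdf.
- exact: mpdf.
Qed.

(** The density is a version of the Radon-Nikodym derivative, by uniqueness of
    the latter almost everywhere. *)
Lemma integral_normal_prob (m s : R) (f : R -> \bar R) :
  measurable_fun setT f -> (normal_prob m s).-integrable setT f ->
  (\int[normal_prob m s]_x f x = \int[mu]_x (f x * (normal_pdf m s x)%:E))%E.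
Proof.
move=> mf intf.
rewrite -(Radon_Nikodym_change_of_variables (normal_prob_dominates m s))//=.
apply: ae_eq_integral => //.
- apply: emeasurable_funM => //; apply: (measurable_int mu).
  by apply: Radon_Nikodym_integrable; exact: normal_prob_dominates.
- apply: emeasurable_funM => //=; apply/measurableT_comp => //=.
  exact: measurable_normal_pdf.
- apply: ae_eqe_mul2l => /=.
  rewrite Radon_NikodymE//=; first exact: normal_prob_dominates.
  move=> abmu.
  case: cid => /= h [h1 h2 h3].
  apply: integral_ae_eq => //=.
  + by apply/measurableT_comp =>//; exact: measurable_normal_pdf.
  + by move=> E E01 mE; rewrite -h3.
Qed.

(** Completing the square in [y]: the joint density of a normal mean [y] and of
    an observation [v] around it, read as the marginal law of [v] times the
    conditional law of [y] given [v]. *)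
Lemma normal_pdf_conv (a t r m q y v : R) : a != 0 -> t != 0 ->
  r ^+ 2 = a ^+ 2 + t ^+ 2 -> m = t ^+ 2 * v / r ^+ 2 -> q = a * t / r ->
  normal_pdf y a v * normal_pdf 0 t y = normal_pdf 0 r v * normal_pdf m q y.
Proof.
move=> a0 t0 r2 mE qE.
have r2_gt0 : 0 < r ^+ 2.
  by rewrite r2 ltr_wpDr ?sqr_ge0// exprn_even_gt0.
have r0 : r != 0 by apply/eqP => r0; rewrite r0 expr0n ltxx in r2_gt0.
have q0 : q != 0 by rewrite qE !mulf_neq0// invr_eq0.
rewrite !normal_pdfE// /normal_peak /normal_fun.
rewrite mulrACA [RHS]mulrACA -!expRD -!invfM -!sqrtrM; last 2 first.
- by rewrite mulrn_wge0// mulr_ge0 ?sqr_ge0// pi_ge0.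
- by rewrite mulrn_wge0// mulr_ge0 ?sqr_ge0// pi_ge0.
have -> : q ^+ 2 = a ^+ 2 * t ^+ 2 / r ^+ 2 by rewrite qE; field.
congr (_ * expR _).
  by congr (Num.sqrt _)^-1; field.
have : a ^+ 2 != 0 by rewrite sqrf_eq0.
have : t ^+ 2 != 0 by rewrite sqrf_eq0.
rewrite mE; move: r2 r2_gt0 => ->.
move: (a ^+ 2) (t ^+ 2) => A T /lt0r_neq0 AT T0 A0.
by field; rewrite ?A0 ?T0 ?AT.
Qed.

Let measurable_normal_pdf2 (a : R) : a != 0 ->
  measurable_fun setT (fun z : measurableTypeR R * measurableTypeR R =>
    normal_pdf z.1 a z.2).
Proof.
move=> a0; under eq_fun do rewrite normal_pdfE// /normal_fun.
apply: measurable_funM => //; apply: measurableT_comp => //.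
apply: measurable_funM => //; apply: measurable_funN.
by apply: measurable_funX; apply: measurable_funB.
Qed.

(** [normal_prob y a A] is the standard normal mass of the section at [y] of
    the measurable planar set where [a z + y] is in [A]. *)
Lemma measurable_normal_prob_mean (a : R) (A : set R) : a != 0 -> measurable A ->
  measurable_fun setT (fun y : measurableTypeR R => normal_prob y a A).
Proof.
move=> a0 mA.
pose B := [set z : measurableTypeR R * measurableTypeR R | A (a * z.1 + z.2)].
have mB : measurable B.
  rewrite -[B]setTI.
  apply: (_ : measurable_fun setT (fun z : measurableTypeR R * measurableTypeR R => a * z.1 + z.2)) => //.
  by apply: measurable_funD => //; apply: measurable_funM.
rewrite (_ : (fun y => _) = normal_prob 0 1 \o ysection B); last first.
  apply/funext => y /=; rewrite -normal_prob_affine//; congr normal_prob.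
  by apply/seteqP; split => z /=; rewrite /ysection/= inE.
exact: measurable_fun_ysection.
Qed.

(** A sum of independent centred normal variables is normal: after exchanging
    the two integrations, [normal_pdf_conv] leaves the density of the sum times
    a probability density that integrates to 1. *)
Lemma normal_prob_conv (a t r : R) (A : set R) : a != 0 -> t != 0 ->
  r ^+ 2 = a ^+ 2 + t ^+ 2 -> measurable A ->
  (\int[normal_prob 0 t]_y normal_prob y a A = normal_prob 0 r A)%E.
Proof.
move=> a0 t0 r2 mA.
have mN := measurable_normal_prob_mean a0 mA.
have indE (f : R -> R) :
    (\int[mu]_(x in A) (f x)%:E = \int[mu]_x (\1_A x * f x)%:E)%E.
  rewrite integral_mkcond; apply: eq_integral => x _.
  by rewrite patchE indicE; case: ifP => _; rewrite ?mul1r ?mul0r.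
pose f (z : measurableTypeR R * measurableTypeR R) : \bar R :=
  (\1_A z.2 * (normal_pdf z.1 a z.2 * normal_pdf 0 t z.1))%:E.
have mf : measurable_fun setT f.
  apply/measurable_EFinP; apply: measurable_funM.
    have m1 : measurable_fun setT (\1_A : measurableTypeR R -> R).
      exact: measurable_indic.
    exact: (measurableT_comp m1 measurable_snd).
  apply: measurable_funM; first exact: measurable_normal_pdf2.
  have mpdf : measurable_fun setT (normal_pdf 0 t : measurableTypeR R -> R).
    exact: measurable_normal_pdf.
  exact: (measurableT_comp mpdf measurable_fst).
have f_ge0 z : (0 <= f z)%E.
  by rewrite lee_fin !mulr_ge0 ?normal_pdf_ge0// indicE.
transitivity (\int[mu]_y \int[mu]_v f (y, v))%E.
  rewrite integral_normal_prob//; last first.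
    apply: (@le_integrable _ _ _ _ _ _ _ (cst 1%E)) => //.
      by move=> y _ /=; rewrite gee0_abs// normr1 probability_le1.
    exact: finite_measure_integrable_cst.
  apply: eq_integral => y _; rewrite {1}/normal_prob indE.
  rewrite -ge0_integralZr//=.
  - by apply: eq_integral => v _; rewrite /f/= -EFinM mulrA.
  - apply/measurable_EFinP; apply: measurable_funM; first exact: measurable_indic.
    exact: measurable_normal_pdf.
  - by move=> x _; rewrite lee_fin mulr_ge0 ?normal_pdf_ge0// indicE.
  - by rewrite lee_fin normal_pdf_ge0.
rewrite fubini_tonelli// /normal_prob indE; apply: eq_integral => v _.
transitivity (\int[mu]_y ((\1_A v * normal_pdf 0 r v)%:E *
    (normal_pdf (t ^+ 2 * v / r ^+ 2) (a * t / r) y)%:E))%E.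
  apply: eq_integral => y _; rewrite /f/= -EFinM; congr EFin.
  by rewrite (@normal_pdf_conv a t r _ _ y v a0 t0 r2 erefl erefl) mulrA.
rewrite ge0_integralZl//=.
- by rewrite integral_normal_pdf mule1.
- by apply/measurable_EFinP; exact: measurable_normal_pdf.
- by move=> x _; rewrite lee_fin normal_pdf_ge0.
- by rewrite lee_fin mulr_ge0 ?normal_pdf_ge0// indicE.
Qed.

End normal_law.

(** * Law of a projection of the standard normal vector *)

Section directional_law.
Context {R : realType}.

Lemma measurable_dotp n (u : 'cV[R]_n) :
  measurable_fun setT (dotp u : Rn R n -> measurableTypeR R).
Proof.
apply: measurable_sum => i; apply: measurable_funM => //.
exact: measurable_tnth.
Qed.

Let tail n (u : 'cV[R]_n.+1) : 'cV[R]_n := \col_i u (lift ord0 i) 0.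

Let dotp_Rcons n (u : 'cV[R]_n.+1) z (x : Rn R n) :
  dotp u (Rcons (z, x)) = u 0 0 * z + dotp (tail u) x.
Proof.
rewrite /dotp big_ord_recl; congr (_ * _ + _).
by apply: eq_bigr => i _; rewrite tnthS mxE.
Qed.

Lemma normal_prob_sqr (s r : R) (A : set R) : s ^+ 2 = r ^+ 2 -> s != 0 ->
  normal_prob 0 s A = normal_prob 0 r A.
Proof.
move=> sr s0; rewrite /normal_prob; apply: eq_integral => x _.
have r0 : r != 0 by rewrite -sqrf_eq0 -sr sqrf_eq0.
by rewrite !normal_pdfE// /normal_peak /normal_fun sr.
Qed.

(** Rotation invariance of N(0, I), by adding one coordinate at a time. The
    degenerate cases are split off because [normal_prob 0 0] is not the Dirac
    mass at 0. *)
Lemma std_normal_dotp n (u : 'cV[R]_n) (s : R) (A : set R) : s != 0 ->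
  s ^+ 2 = \sum_i u i 0 ^+ 2 -> measurable A ->
  std_normal n (dotp u @^-1` A) = normal_prob 0 s A.
Proof.
elim: n u s A => [|n IHn] u s A s0.
  by rewrite big_ord0 => /eqP; rewrite sqrf_eq0 (negbTE s0).
rewrite big_ord_recl => s2 mA.
have tailE : \sum_(i < n) u (lift ord0 i) 0 ^+ 2 = \sum_i tail u i 0 ^+ 2.
  by apply: eq_bigr => i _; rewrite mxE.
rewrite tailE in s2.
have tail_ge0 : 0 <= \sum_i tail u i 0 ^+ 2 by apply: sumr_ge0 => i _; exact: sqr_ge0.
rewrite /= /distribution /pushforward.
rewrite [X in (_ \x _)%E X](_ : _ = [set z | A (u 0 0 * z.1 + dotp (tail u) z.2)]); last first.
  by apply/seteqP; split => -[z x] /=; rewrite dotp_Rcons.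
have [u00|u00] := eqVneq (u 0 0) 0.
  rewrite (_ : [set z | _] = setT `*` (dotp (tail u) @^-1` A)); last first.
    by apply/seteqP; split => -[z x] /=; rewrite u00 mul0r add0r//; case.
  rewrite product_measure1E//; last first.
    by rewrite -[X in measurable X]setTI; exact: measurable_dotp.
  rewrite [X in (X * _)%E](_ : _ = 1%E) ?mul1e; last exact: probability_setT.
  apply: IHn => //.
  by rewrite s2 u00 expr0n add0r.
have [t0|t0] := eqVneq (\sum_i tail u i 0 ^+ 2) 0.
  have tail0 x : dotp (tail u) x = 0.
    rewrite /dotp big1// => i _.
    have /eqP := t0; rewrite psumr_eq0; last by move=> j _; exact: sqr_ge0.
    by move=> /allP/(_ i (mem_index_enum _))/=; rewrite sqrf_eq0 => /eqP ->; rewrite mul0r.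
  rewrite (_ : [set z | _] = (affine (u 0 0) 0 @^-1` A) `*` setT); last first.
    by apply/seteqP; split => -[z x] /=; rewrite tail0 /affine//; case.
  rewrite product_measure1E//; last first.
    by rewrite -[X in measurable X]setTI; exact: measurable_affine.
  rewrite [X in (_ * X)%E](_ : _ = 1%E) ?mule1; last exact: probability_setT.
  apply: etrans (normal_prob_affine 0 u00 mA) _.
  by apply: normal_prob_sqr => //; rewrite s2 t0 addr0.
pose t := Num.sqrt (\sum_i tail u i 0 ^+ 2).
have t2 : t ^+ 2 = \sum_i tail u i 0 ^+ 2 by rewrite sqr_sqrtr.
have tn0 : t != 0 by rewrite -sqrf_eq0 t2.
set S := [set z | _].
have mS : measurable S.
  rewrite -[S]setTI.
  apply: (_ : measurable_fun setT (fun z : measurableTypeR R * Rn R n =>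
    u 0 0 * z.1 + dotp (tail u) z.2)) => //.
  apply: measurable_funD; first exact: measurable_funM.
  exact: (measurableT_comp (measurable_dotp (tail u)) measurable_snd).
rewrite (product_measure_unique (m' := (normal_prob 0 1 \x^ std_normal n)%E))//; last first.
  by move=> B C mB mC; exact: product_measure2E.
rewrite /product_measure2.
transitivity (\int[std_normal n]_x normal_prob (dotp (tail u) x) (u 0 0)%R A)%E.
  apply: eq_integral => x _ /=.
  apply: etrans (normal_prob_affine _ u00 mA); congr (normal_prob 0 1).
  by apply/seteqP; split => z /=; rewrite /ysection/= inE.
rewrite -(normal_prob_conv u00 tn0 _ mA); last by rewrite t2.
rewrite -(ge0_integral_pushforward (measurable_dotp (tail u)) _ measurableT
  (measurable_normal_prob_mean u00 mA))//.
apply: eq_measure_integral => [|? B mB _]; first exact: measurable_dotp.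
exact: IHn.
Qed.

End directional_law.

(** * Absolute value of a standard normal variable *)

Section abs_normal.
Context {R : realType}.
Notation N := (normal_prob (0 : R) 1).

Definition abs_in (i : interval R) : set (measurableTypeR R) :=
  [set z | `|z| \in i].

Lemma measurable_abs_in i : measurable (abs_in i).
Proof.
rewrite -[abs_in i]setTI.
have mabs : measurable_fun setT (fun z : measurableTypeR R => `|z| : measurableTypeR R).
  exact: normr_measurable.
by apply: (mabs _ [set` i]).
Qed.
#[local] Hint Resolve measurable_abs_in : core.

Lemma le_abs_in i j : (i <= j)%O -> (N (abs_in i) <= N (abs_in j))%E.
Proof.
move=> ij; apply: le_measure; rewrite ?inE//.
by move=> z; rewrite /abs_in/=; exact: (subitvP ij).
Qed.

(** Lipschitz constant of the distribution function of [`|Z|]: its density is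
    at most twice the peak of the normal density. *)
Definition abs_slope : R := 2 * normal_peak 1.

Lemma abs_slope_ge0 : 0 <= abs_slope.
Proof. by rewrite mulr_ge0// normal_peak_ge0. Qed.

Lemma normal_prob_annulus a b : a <= b ->
  (N (abs_in `[a, b]) <= (abs_slope * (b - a))%:E)%E.
Proof.
move=> ab.
have Nitv x y : x <= y -> (N `[x, y] <= (normal_peak 1 * (y - x))%:E)%E.
  move=> xy; rewrite /normal_prob.
  apply: (@le_trans _ _ (\int[lebesgue_measure]_(z in `[x, y]) (normal_peak (1 : R))%:E)%E).
    apply: ge0_le_integral => //=.
    - by move=> z _; rewrite lee_fin normal_pdf_ge0.
    - by apply/measurable_funTS/measurable_EFinP; exact: measurable_normal_pdf.
    - by move=> z _; rewrite lee_fin normal_pdf_ub// oner_neq0.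
  rewrite integral_cst//= lebesgue_measure_itv/= lte_fin.
  by move: xy; rewrite le_eqVlt => /predU1P[->|->]; rewrite ?ltxx ?subrr ?mulr0 ?mule0.
apply: (@le_trans _ _ (N (`[a, b] `|` `[- b, - a]))).
  apply: le_measure; rewrite ?inE//; first exact: measurableU.
  move=> z; rewrite /abs_in/= !in_itv/= ler_norml => /andP[az /andP[zb1 zb2]].
  have [z0|z0] := leP 0 z.
    by left; rewrite ger0_norm// in az; rewrite az.
  by right; rewrite ltr0_norm// in az; apply/andP; split; lra.
apply: (le_trans (measureU2 _ _ _)) => //.
rewrite (_ : (abs_slope * (b - a))%:E = (normal_peak 1 * (b - a))%:E +
  (normal_peak 1 * (- a - - b))%:E)%E; last first.
  by rewrite -EFinD /abs_slope; congr EFin; ring.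
by apply: leeD; apply: Nitv; lra.
Qed.

Lemma normal_prob_abs_leD s t : s <= t ->
  (N (abs_in `]-oo, t]) <= N (abs_in `]-oo, s]) + (abs_slope * (t - s))%:E)%E.
Proof.
move=> st; apply: (@le_trans _ _ (N (abs_in `]-oo, s] `|` abs_in `[s, t]))).
  apply: le_measure; rewrite ?inE//; first exact: measurableU.
  move=> z; rewrite /abs_in/= !in_itv/= => zt; case: (leP `|z| s) => zs; [left|right] => //.
  by rewrite zt (ltW zs).
apply: (le_trans (measureU2 _ _ _)) => //.
by rewrite leeD2l//; exact: normal_prob_annulus.
Qed.

Lemma normal_prob_abs_geD s t : s <= t ->
  (N (abs_in `[s, +oo[) <= N (abs_in `]t, +oo[) + (abs_slope * (t - s))%:E)%E.
Proof.
move=> st; apply: (@le_trans _ _ (N (abs_in `]t, +oo[ `|` abs_in `[s, t]))).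
  apply: le_measure; rewrite ?inE//; first exact: measurableU.
  move=> z; rewrite /abs_in/= !in_itv/= !andbT => sz; case: (ltP t `|z|) => zs; [left|right] => //.
  by rewrite sz.
apply: (le_trans (measureU2 _ _ _)) => //.
by rewrite leeD2l//; exact: normal_prob_annulus.
Qed.

Lemma normal_prob_abs_gt t : N (abs_in `]t, +oo[) = (1 - N (abs_in `]-oo, t]))%E.
Proof.
rewrite -probability_setC//; congr (normal_prob 0 1).
by apply/seteqP; split => z; rewrite /abs_in/= !in_itv/= andbT; [move=> h; apply/negP|move/negP]; rewrite -ltNge.
Qed.

Lemma normal_prob_abs_le_eq0 t : t <= 0 -> N (abs_in `]-oo, t]) = 0%E.
Proof.
move=> t0; apply/eqP; rewrite eq_le measure_ge0 andbT.
apply: (@le_trans _ _ (N (abs_in `[0, 0]))).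
  apply: le_measure; rewrite ?inE//.
  move=> z; rewrite /abs_in/= !in_itv/= normr_ge0/= => /le_trans; exact.
by apply: (le_trans (normal_prob_annulus _)) => //; rewrite subrr mulr0.
Qed.

Lemma normal_prob_abs_tail (d : R) : 0 < d ->
  exists t : R, (0 < t) /\ (N (abs_in `]t, +oo[) <= d%:E)%E.
Proof.
move=> d0.
have cvg1 : N \o (fun n => abs_in `]-oo, n.+1%:R]) @ \oo --> N (\bigcup_n abs_in `]-oo, n.+1%:R]).
  apply: nondecreasing_cvg_mu => //; first exact: bigcup_measurable.
  move=> m n mn; apply/subsetPset => z; rewrite /abs_in/= !in_itv/= => /le_trans; apply.
  by rewrite ler_nat.
have UT : \bigcup_n abs_in `]-oo, n.+1%:R] = setT.
  apply/seteqP; split => // z _; exists (Num.truncn `|z|) => //.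
  by rewrite /abs_in/= in_itv/= ltW// truncnS_gt.
rewrite UT [X in _ --> X](_ : _ = 1%:E) in cvg1; last exact: probability_setT.
have /fine_cvgP[fn /cvgrPdist_le/(_ d d0) cvgd] := cvg1.
near \oo => n; exists n.+1%:R; split => //.
rewrite normal_prob_abs_gt.
have : `|1 - fine ((N \o (fun n => abs_in `]-oo, n.+1%:R])) n)| <= d by near: n.
have nf : N (abs_in `]-oo, n.+1%:R]) \is a fin_num by near: n.
move=> /(le_trans (ler_norm _)) le_d.
by rewrite -(fineK nf) -EFinB lee_fin.
Unshelve. all: by end_near. Qed.

Lemma normal_prob_abs_median :
  exists b : R, 0 < b /\ N (abs_in `]-oo, b]) = 2^-1%:E.
Proof.
pose h t := fine (N (abs_in `]-oo, t])).
have hE t : N (abs_in `]-oo, t]) = (h t)%:E.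
  by rewrite /h fineK// fin_num_measure.
have hmono s t : s <= t -> h s <= h t.
  by move=> st; rewrite -lee_fin -!hE le_abs_in// subitvE/= !bnd_simp.
have hD s t : s <= t -> h t <= h s + abs_slope * (t - s).
  by move=> st; rewrite -lee_fin EFinD -!hE normal_prob_abs_leD.
have hlip x y : `|h x - h y| <= abs_slope * `|x - y|.
  wlog xy : x y / x <= y.
    by move=> H; have [/H//|/ltW/H] := leP x y; rewrite distrC [`|y - x|]distrC.
  rewrite ler0_norm ?subr_le0 ?hmono// ler0_norm ?subr_le0//.
  by have := hD _ _ xy; lra.
have hcont : continuous h.
  have s1 : 0 < abs_slope + 1 by have := abs_slope_ge0; lra.
  move=> x; apply/cvgrPdist_le => e e0; near=> y.
  apply: (le_trans (hlip _ _)).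
  apply: (@le_trans _ _ ((abs_slope + 1) * `|x - y|)).
    by rewrite ler_wpM2r//; lra.
  rewrite mulrC -ler_pdivlMr//.
  near: y; apply: (@cvgr_dist_le _ _ _ _ _ id x cvg_id).
  exact: divr_gt0.
have [T [T0]] := @normal_prob_abs_tail 2^-1 ltac:(by rewrite invr_gt0).
rewrite normal_prob_abs_gt hE -EFinB lee_fin => hT.
have h0 : h 0 = 0 by rewrite /h normal_prob_abs_le_eq0.
have [||b] := @IVT _ h 0 T 2^-1 (ltW T0).
- exact: continuous_subspaceT.
- by rewrite h0 ge_min invr_ge0 ler0n/= le_max; apply/orP; right; lra.
rewrite in_itv/= => /andP[b0 _] hb; exists b; rewrite hE hb; split => //.
rewrite lt_neqAle b0 andbT; apply/eqP => b00.
by move: hb; rewrite -b00 h0 => /eqP; rewrite eq_sym invr_eq0 pnatr_eq0.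
Unshelve. all: by end_near. Qed.

End abs_normal.

(** * Quadratic forms *)

Section quadratic_forms.
Context {R : realType} {n : nat}.
Implicit Types (G : 'M[R]_n) (u v : 'cV[R]_n).

Definition bform G u v : R := (u^T *m G *m v) 0 0.

Lemma qform_scaleD G u v (s : R) : G^T = G ->
  qform G (u + s *: v) = qform G u + 2 * s * bform G u v + s ^+ 2 * qform G v.
Proof.
move=> Gs; have -> : 2 * s * bform G u v = s * bform G u v + s * bform G v u.
  have -> : bform G v u = bform G u v.
    rewrite /bform; transitivity ((u^T *m G *m v)^T 0 0); last by rewrite mxE.
    by rewrite !trmx_mul trmxK Gs mulmxA.
  by ring.
rewrite /qform /bform.
have -> : (u + s *: v)^T = u^T + s *: v^T by rewrite linearD linearZ.
rewrite !mulmxDl !mulmxDr -!scalemxAl -!scalemxAr.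
by rewrite !mxE; ring.
Qed.

Lemma qformZ G u (c : R) : qform G (c *: u) = c ^+ 2 * qform G u.
Proof.
rewrite /qform; have -> : (c *: u)^T = c *: u^T by rewrite linearZ.
by rewrite -!scalemxAl -scalemxAr !mxE; ring.
Qed.

Lemma qform1E u : qform 1%:M u = \sum_i u i 0 ^+ 2.
Proof.
by rewrite /qform mulmx1 mxE; apply: eq_bigr => i _; rewrite mxE expr2.
Qed.

Lemma sphereE u : sphere u = (qform 1%:M u = 1).
Proof. by rewrite qform1E. Qed.

Lemma qform1_ge0 u : 0 <= qform 1%:M u.
Proof. by rewrite qform1E; apply: sumr_ge0 => i _; exact: sqr_ge0. Qed.

Lemma qform1_gt0 u : u != 0 -> 0 < qform 1%:M u.
Proof.
move=> u0; rewrite lt_neqAle qform1_ge0 andbT eq_sym; apply: contra u0.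
rewrite qform1E psumr_eq0; last by move=> i _; exact: sqr_ge0.
move=> /allP u0; apply/eqP/matrixP => i j; rewrite !ord1 mxE.
by apply/eqP; rewrite -sqrf_eq0; exact: (u0 i (mem_index_enum _)).
Qed.

Lemma sphere_neq0 u : sphere u -> u != 0.
Proof.
rewrite sphereE => u1; apply/eqP => u0.
by move: u1; rewrite u0 /qform mulmx0 mxE => /eqP; rewrite eq_sym oner_eq0.
Qed.

Lemma spd_unitmx G : spd G -> G \in unitmx.
Proof.
move=> [_ Gpos]; rewrite unitmxE unitfE; apply/det0P => -[v v0 vG].
have := Gpos v^T; rewrite trmx_eq0 => /(_ v0).
by rewrite /qform trmxK vG mul0mx mxE ltxx.
Qed.

Lemma qform_sphere_ge G (s : R) u : u != 0 ->
  (forall v, sphere v -> s <= qform G v) -> s * qform 1%:M u <= qform G u.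
Proof.
move=> u0 sG; have qu := qform1_gt0 u0.
pose c := (Num.sqrt (qform 1%:M u))^-1.
have c2 : c ^+ 2 = (qform 1%:M u)^-1 by rewrite exprVn sqr_sqrtr// ltW.
have /sG : sphere (c *: u) by rewrite sphereE qformZ c2 mulVf// gt_eqF.
by rewrite qformZ c2 mulrC ler_pdivlMr// mulrC.
Qed.

(** With [v = G^-1 u] the number to bound is [u^t v = v^t G v]. The Cauchy-Schwarz
    inequality for the form of [G] gives the lower bound, and for the Euclidean
    form, combined with [s0 |v|^2 <= v^t G v], the upper one. Both are used in
    expanded form, as positivity of the square of [u - s v] for a suitable [s]. *)
Lemma qform_invmx_bounds G (s0 s1 : R) : spd G -> 0 < s0 -> 0 < s1 ->
  (forall u, sphere u -> s0 <= qform G u <= s1) ->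
  forall u, sphere u -> s1^-1 <= qform (invmx G) u <= s0^-1.
Proof.
move=> Gspd s0_gt0 s1_gt0 sG u u1.
have [GT Gpos] := Gspd; have Gu := spd_unitmx Gspd.
pose v := invmx G *m u.
have Gv : G *m v = u by rewrite mulmxA mulmxV// mul1mx.
have qE : qform (invmx G) u = bform 1%:M u v by rewrite /qform /bform mulmx1 mulmxA.
have vE : qform G v = qform (invmx G) u.
  rewrite /qform -mulmxA Gv /v trmx_mul trmx_inv GT.
  by [].
have v0 : v != 0.
  by apply: contra (sphere_neq0 u1) => /eqP v0; rewrite -Gv v0 mulmx0.
have D_gt0 : 0 < qform (invmx G) u by rewrite -vE Gpos.
set D := qform (invmx G) u in qE vE D_gt0 *.
have GuvE : bform G u v = 1.
  by rewrite /bform -mulmxA Gv; move: u1; rewrite sphereE /qform mulmx1.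
apply/andP; split.
  have : 0 <= qform G (u + (- s1) *: v).
    have [->|/Gpos/ltW//] := eqVneq (u + - s1 *: v) 0.
    by rewrite /qform mulmx0 mxE.
  rewrite qform_scaleD// GuvE vE.
  have /andP[_ qs1] := sG _ u1.
  move=> h; rewrite -[leLHS]mulr1 ler_pdivrMl//.
  by rewrite -(ler_pM2l s1_gt0); nra.
have := qform1_ge0 (u + (- s0) *: v).
rewrite qform_scaleD ?trmx1// -qE.
have := qform_sphere_ge v0 (fun w w1 => proj1 (andP (sG w w1))).
move: u1; rewrite sphereE vE => -> h1 h2.
rewrite -[leRHS]mulr1 ler_pdivlMl//.
by nra.
Qed.

End quadratic_forms.

(** * Depth under contamination, and finite bias below one third *)

Section halfspace_events.
Context {R : realType} {p : nat}.
Notation N := (normal_prob (0 : R) 1).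
Notation P0 := (@std_normal R p).
Implicit Types (G : 'M[R]_p) (u : 'cV[R]_p) (q e : R).
Implicit Types (P : probability (Rn R p) R).

Definition inner u q : set (Rn R p) := [set x | `|dotp u x| ^+ 2 <= q].
Definition outer u q : set (Rn R p) := [set x | `|dotp u x| ^+ 2 >= q].

Lemma innerE u q : 0 <= q -> inner u q = dotp u @^-1` abs_in `]-oo, Num.sqrt q].
Proof.
move=> q0.
have H (y : R) : (`|y| ^+ 2 <= q) = (`|y| <= Num.sqrt q).
  by rewrite -(ler_sqrt (`|y| ^+ 2) q0) sqrtr_sqr normr_id.
by apply/seteqP; split => x; rewrite /inner /abs_in/= in_itv/= H.
Qed.

Lemma outerE u q : 0 <= q -> outer u q = dotp u @^-1` abs_in `[Num.sqrt q, +oo[.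
Proof.
move=> q0.
have H (y : R) : (q <= `|y| ^+ 2) = (Num.sqrt q <= `|y|).
  by rewrite -(ler_sqrt q (sqr_ge0 `|y|)) sqrtr_sqr normr_id.
by apply/seteqP; split => x; rewrite /outer /abs_in/= in_itv/= andbT H.
Qed.

Lemma measurable_dotp_abs_in u i : measurable (dotp u @^-1` abs_in i : set (Rn R p)).
Proof.
rewrite -[X in measurable X]setTI; apply: measurable_dotp => //.
exact: measurable_abs_in.
Qed.

Lemma measurable_inner u q : 0 <= q -> measurable (inner u q).
Proof. by move=> q0; rewrite innerE//; exact: measurable_dotp_abs_in. Qed.

Lemma measurable_outer u q : 0 <= q -> measurable (outer u q).
Proof. by move=> q0; rewrite outerE//; exact: measurable_dotp_abs_in. Qed.

Lemma std_normal_abs_in u i : sphere u ->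
  P0 (dotp u @^-1` abs_in i) = N (abs_in i).
Proof.
move=> u1; apply: std_normal_dotp; rewrite ?oner_neq0//; last exact: measurable_abs_in.
by rewrite expr1n u1.
Qed.

Lemma scatter_depth_le_inner G P u : sphere u ->
  (scatter_depth G P <= P (inner u (qform G u)))%E.
Proof.
move=> u1; apply: ge_ereal_inf; eexists; first by exists u.
by rewrite ge_min lexx.
Qed.

Lemma scatter_depth_le_outer G P u : sphere u ->
  (scatter_depth G P <= P (outer u (qform G u)))%E.
Proof.
move=> u1; apply: ge_ereal_inf; eexists; first by exists u.
by rewrite ge_min lexx orbT.
Qed.

Lemma scatter_depth_ge G P (d : \bar R) :
  (forall u, sphere u -> (d <= P (inner u (qform G u)))%E /\
                         (d <= P (outer u (qform G u)))%E) ->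
  (d <= scatter_depth G P)%E.
Proof.
move=> H; apply: le_ereal_inf_tmp => _ [u u1 <-].
by have [h1 h2] := H u u1; rewrite le_min h1 h2.
Qed.

Lemma contamination_ge e P A : 0 <= e -> contamination e P0 P -> measurable A ->
  ((1 - e)%:E * P0 A <= P A)%E.
Proof.
move=> e0 [Q PE] mA; rewrite PE// leeDl//.
by rewrite mule_ge0.
Qed.

Lemma contamination_le e P A : 0 <= e <= 1 -> contamination e P0 P -> measurable A ->
  (P A <= P0 A + e%:E)%E.
Proof.
move=> /andP[e0 e1] [Q PE] mA; rewrite PE//; apply: leeD.
  rewrite -[leRHS]mul1e; apply: lee_wpmul2r => //.
  by rewrite lee_fin; lra.
by rewrite -[leRHS]mule1; apply: lee_wpmul2l; rewrite ?lee_fin// probability_le1.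
Qed.

Section median.
Variable b : R.
Hypotheses (b_gt0 : 0 < b) (b_median : N (abs_in `]-oo, b]) = (2^-1)%:E).

Lemma normal_prob_abs_ge_median : N (abs_in `[b, +oo[) = (2^-1)%:E.
Proof.
have gt : N (abs_in `]b, +oo[) = (2^-1)%:E.
  by rewrite normal_prob_abs_gt b_median -EFinB; congr EFin; lra.
apply/eqP; rewrite eq_le; apply/andP; split.
  by have := normal_prob_abs_geD (lexx b); rewrite gt subrr mulr0 adde0.
by rewrite -[leLHS]gt le_abs_in// subitvE/= !bnd_simp.
Qed.

Lemma half_le_contamination e P A : 0 <= e < 1 -> contamination e P0 P ->
  measurable A -> ((2^-1)%:E <= P0 A)%E -> (((1 - e) / 2)%:E <= P A)%E.
Proof.
move=> /andP[e0 e1] PP0 mA hA; apply: le_trans (contamination_ge e0 PP0 mA).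
by rewrite EFinM; apply: lee_wpmul2l => //; rewrite lee_fin; lra.
Qed.

Lemma scatter_depth_spherical_ge e P : 0 <= e < 1 -> contamination e P0 P ->
  (((1 - e) / 2)%:E <= scatter_depth (b ^+ 2)%:M P)%E.
Proof.
move=> e01 PP0; apply: scatter_depth_ge => u u1.
have -> : qform (b ^+ 2)%:M u = b ^+ 2.
  rewrite -scalemx1 /qform -scalemxAr -scalemxAl mxE -/(qform _ _).
  by move: u1; rewrite sphereE => ->; rewrite mulr1.
have b2 : 0 <= b ^+ 2 by rewrite sqr_ge0.
have sb : Num.sqrt (b ^+ 2) = b by rewrite sqrtr_sqr gtr0_norm.
split; apply: half_le_contamination => //.
- exact: measurable_inner.
- by rewrite innerE// sb std_normal_abs_in// b_median.
- exact: measurable_outer.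
- by rewrite outerE// sb std_normal_abs_in// normal_prob_abs_ge_median.
Qed.

Lemma spd_scalar (c : R) : 0 < c -> spd (c%:M : 'M[R]_p).
Proof.
move=> c0; split; first by rewrite tr_scalar_mx.
move=> u u0; rewrite -scalemx1 /qform -scalemxAr -scalemxAl mxE -/(qform _ _).
by rewrite mulr_gt0// qform1_gt0.
Qed.

(** A deepest matrix is at least as deep as [b^2 I]. For [e < 1/3] the gap
    between [(1 - e) / 2] and [e] is positive, and it forces each slab and each
    complement of a slab to keep some mass of the normal law. *)
Lemma deepest_qform_bounds e : 0 <= e < 3^-1 ->
  exists s0 s1 : R, [/\ 0 < s0, 0 < s1 & forall P G,
    contamination e P0 P -> deepest P G ->
    forall u, sphere u -> s0 <= qform G u <= s1].
Proof.
move=> /andP[e0 e3].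
(* [d] is half of the gap between [(1 - e) / 2] and [e] *)
pose d := (1 - 3 * e) / 4.
have d0 : 0 < d by rewrite divr_gt0//; lra.
have [t [t0 Nt]] := normal_prob_abs_tail d0.
pose r := d / (@abs_slope R + 1).
have K1 : 0 < @abs_slope R + 1 by have := @abs_slope_ge0 R; lra.
have r0 : 0 < r by rewrite divr_gt0.
have Nr : (N (abs_in `]-oo, r]) <= d%:E)%E.
  apply: (le_trans (normal_prob_abs_leD (ltW r0))).
  rewrite normal_prob_abs_le_eq0// add0e lee_fin subr0 /r mulrA ler_pdivrMr// mulrC.
  by rewrite ler_pM2l//; lra.
exists (r ^+ 2), (t ^+ 2); split; [exact: exprn_gt0|exact: exprn_gt0|].
move=> P G PP0 [Gspd Gmax] u u1.
have qu : 0 < qform G u by apply: (proj2 Gspd); exact: sphere_neq0.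
have e01 : 0 <= e < 1 by rewrite e0/=; lra.
have e01' : 0 <= e <= 1 by rewrite e0/=; lra.
have depthG : (((1 - e) / 2)%:E <= scatter_depth G P)%E.
  apply: le_trans (scatter_depth_spherical_ge e01 PP0) _; apply: Gmax.
  by apply: spd_scalar; exact: exprn_gt0.
have absurd A : measurable A -> (P0 A <= d%:E)%E -> ~ (scatter_depth G P <= P A)%E.
  move=> mA Ad /(le_trans depthG)/le_trans/(_ (contamination_le e01' PP0 mA)).
  move=> /le_trans/(_ (leeD Ad (lexx _))); rewrite -EFinD lee_fin /d.
  by move=> h; lra.
apply/andP; split; rewrite leNgt; apply/negP => qlt.
- apply: (absurd (inner u (qform G u))); last exact: scatter_depth_le_inner.
    exact: measurable_inner (ltW qu).
  rewrite innerE ?(ltW qu)// std_normal_abs_in//; apply: le_trans Nr.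
  apply: le_abs_in; rewrite subitvE/= !bnd_simp.
  by rewrite -(ger0_norm (ltW r0)) -sqrtr_sqr ler_sqrt ?sqr_ge0// ltW.
- apply: (absurd (outer u (qform G u))); last exact: scatter_depth_le_outer.
    exact: measurable_outer (ltW qu).
  rewrite outerE ?(ltW qu)// std_normal_abs_in//; apply: le_trans Nt.
  apply: le_abs_in; rewrite subitvE/= !bnd_simp andbT.
  by rewrite -(ger0_norm (ltW t0)) -sqrtr_sqr ltr_sqrt.
Qed.

End median.

Lemma max_bias_lty (bias : 'M[R]_p -> 'M[R]_p -> \bar R) e (C : R) :
  (forall P G G0, contamination e P0 P -> deepest P G -> deepest P0 G0 ->
    (bias G G0 <= C%:E)%E) ->
  max_bias bias e P0 <> +oo%E.
Proof.
move=> biasC maxy.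
suff : (max_bias bias e P0 <= C%:E)%E by rewrite maxy.
by apply: ge_ereal_sup => _ [P [G [G0 [PP0 dG dG0 ->]]]]; exact: (biasC P).
Qed.

Lemma contamination0 : contamination 0 P0 P0.
Proof. by exists P0 => A mA; rewrite subr0 mul1e mul0e adde0. Qed.

Lemma max_biases_lty e : 0 <= e < 3^-1 ->
  max_bias explosion_bias e P0 <> +oo%E /\ max_bias implosion_bias e P0 <> +oo%E.
Proof.
move=> e3; have [b [b0 bm]] := @normal_prob_abs_median R.
have [s0 [s1 [s0_gt0 s1_gt0 sP]]] := deepest_qform_bounds b0 bm e3.
have e03 : 0 <= (0 : R) < 3^-1 by rewrite lexx invr_gt0 ltr0n.
have [r0 [r1 [r0_gt0 r1_gt0 rP]]] := deepest_qform_bounds b0 bm e03.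
have ratio (x y C c : R) : 0 < c -> c <= y -> x <= C -> 0 <= C -> x / y <= C / c.
  move=> c0 cy xC C0; have y0 := lt_le_trans c0 cy.
  rewrite ler_pdivrMr// mulrAC ler_pdivlMr//; apply: (@le_trans _ _ (C * c)).
    by rewrite ler_wpM2r// ltW.
  by rewrite ler_wpM2l.
split.
- apply: (@max_bias_lty _ _ (s1 / r0)) => P G G0 PP0 dG dG0.
  apply: ge_ereal_sup => _ [u u1 <-]; rewrite lee_fin.
  have /andP[_ ?] := sP _ _ PP0 dG _ u1.
  have /andP[? _] := rP _ _ contamination0 dG0 _ u1.
  by apply: ratio => //; exact: ltW.
- apply: (@max_bias_lty _ _ (s0^-1 / r1^-1)) => P G G0 PP0 dG dG0.
  apply: ge_ereal_sup => _ [u u1 <-]; rewrite lee_fin.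
  have /andP[_ ?] := qform_invmx_bounds (proj1 dG) s0_gt0 s1_gt0 (sP _ _ PP0 dG) u1.
  have /andP[? _] := qform_invmx_bounds (proj1 dG0) r0_gt0 r1_gt0 (rP _ _ contamination0 dG0) u1.
  by apply: ratio => //; rewrite ?invr_gt0 ?invr_ge0// ltW.
Qed.

Lemma breakdown_point_ge (bias : 'M[R]_p -> 'M[R]_p -> \bar R) :
  (forall e, 0 <= e < 3^-1 -> max_bias bias e P0 <> +oo%E) ->
  ((3^-1 : R)%:E <= breakdown_point bias P0)%E.
Proof.
move=> H; apply: le_ereal_inf_tmp => _ [e [/andP[e0 e1] ey] <-].
rewrite lee_fin leNgt; apply/negP => e3; apply: (H e) => //.
by rewrite ltW.
Qed.

End halfspace_events.

(** * Contamination by one atom, and infinite bias at one third *)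

Section mixture.
Context {R : realType} d (T : measurableType d).
Variables (P Q : probability T R) (e : R).
Hypotheses (e_ge0 : 0 <= e) (e_le1 : 0 <= 1 - e).

Let component (k : nat) : {measure set T -> \bar R} :=
  if k is 0%N then mscale (NngNum e_le1) P else mscale (NngNum e_ge0) Q.

Definition mixture := msum component 2.

HB.instance Definition _ := Measure.on mixture.

Lemma mixtureE A : mixture A = ((1 - e)%:E * P A + e%:E * Q A)%E.
Proof. by rewrite /mixture /msum 2!big_ord_recl big_ord0 adde0. Qed.

Let mixture_setT : mixture setT = 1%E.
Proof. by rewrite mixtureE !probability_setT !mule1 -EFinD subrK. Qed.

HB.instance Definition _ := Measure_isProbability.Build _ _ _ mixture mixture_setT.

End mixture.

Section dirac_contamination.
Context {R : realType} {p : nat}.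
Notation N := (normal_prob (0 : R) 1).
Notation n := p.+2.
Notation P0 := (@std_normal R n).
Implicit Types (G : 'M[R]_n) (u : 'cV[R]_n) (e : R).
Implicit Types (P : probability (Rn R n) R).

Variable b : R.
Hypotheses (b_gt0 : 0 < b) (b_median : N (abs_in `]-oo, b]) = (2^-1)%:E).

(** A point whose distance to the origin is the median [b], so that it lies on
    the boundary of the slab of [b^2 I] in its own direction. *)
Definition atom : Rn R n := [tuple (if i == 0 then b else 0) | i < n].

Lemma dotp_atom u : dotp u atom = b * u 0 0.
Proof.
rewrite /dotp big_ord_recl tnth_mktuple eqxx big1 ?addr0 1?mulrC// => i _.
by rewrite tnth_mktuple mulr0.
Qed.

Definition dirac_contaminated e P : Prop := forall A, measurable A ->
  P A = ((1 - e)%:E * P0 A + e%:E * \d_atom A)%E.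

Lemma dirac_contaminatedW e P : dirac_contaminated e P -> contamination e P0 P.
Proof. by exists (\d_atom). Qed.

Let e1 : 'cV[R]_n := delta_mx 0 0.
Let e2 : 'cV[R]_n := delta_mx 1 0.

Let qform_e1 : qform 1%:M e1 = 1.
Proof.
rewrite qform1E big_ord_recl big1 ?addr0 => [|i _]; rewrite mxE.
  by rewrite !eqxx expr1n.
by rewrite expr0n.
Qed.

Let qform_e2 : qform 1%:M e2 = 1.
Proof.
rewrite qform1E !big_ord_recl big1 ?addr0 => [|i _]; rewrite !mxE.
  by rewrite !eqxx/= expr0n add0r expr1n.
by rewrite expr0n.
Qed.

Let bform_e12 : bform 1%:M e1 e2 = 0.
Proof.
rewrite /bform mulmx1 mxE big_ord_recl big1 ?addr0 => [|i _]; rewrite !mxE.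
  by rewrite mulr0.
by rewrite /= mul0r.
Qed.

Let dirac_inner0 u q : q < (b * u 0 0) ^+ 2 -> \d_atom (inner u q) = 0%E :> \bar R.
Proof.
move=> h; rewrite diracE memNset// /inner/= dotp_atom => h'.
by move: h; rewrite -real_normK ?num_real// ltNge h'.
Qed.

Let dirac_outer0 u q : (b * u 0 0) ^+ 2 < q -> \d_atom (outer u q) = 0%E :> \bar R.
Proof.
move=> h; rewrite diracE memNset// /outer/= dotp_atom => h'.
by move: h; rewrite -[X in X < _]real_normK ?num_real// ltNge h'.
Qed.

Let dirac_inner1 u q : (b * u 0 0) ^+ 2 <= q -> \d_atom (inner u q) = 1%E :> \bar R.
Proof.
by move=> h; rewrite diracE mem_set// /inner/= dotp_atom real_normK ?num_real.
Qed.

(** Outside a slab whose half-width is at least [b (1 - t)] there is at most half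
    of the normal mass, up to an error that is linear in [t]. *)
Let le_half_outer u q e (t : R) : sphere u -> 0 <= e <= 1 -> 0 <= t < 1 ->
  (b * (1 - t)) ^+ 2 <= q ->
  ((1 - e)%:E * P0 (outer u q) <= ((1 - e) / 2 + abs_slope * b * t)%:E)%E.
Proof.
move=> u1 /andP[e0 e_le1] /andP[t0 t1] hq.
have q0 : 0 <= q := le_trans (sqr_ge0 _) hq.
have bt0 : 0 <= b * (1 - t) by rewrite mulr_ge0 ?ltW// subr_gt0.
rewrite outerE// std_normal_abs_in//.
apply: (@le_trans _ _ ((1 - e)%:E * (2^-1 + abs_slope * b * t)%:E)%E).
  apply: lee_wpmul2l; first by rewrite lee_fin subr_ge0.
  apply: (@le_trans _ _ (N (abs_in `[b * (1 - t), +oo[))).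
    apply: le_abs_in; rewrite subitvE/= !bnd_simp andbT.
    by rewrite -(ger0_norm bt0) -sqrtr_sqr ler_sqrt.
  have btb : b * (1 - t) <= b by rewrite ger_pMr//; lra.
  apply: (le_trans (normal_prob_abs_geD btb)).
  rewrite normal_prob_abs_gt b_median -EFinB -EFinD lee_fin.
  have -> : b - b * (1 - t) = b * t by ring.
  by rewrite mulrA; lra.
rewrite -EFinM lee_fin mulrDr lerD2l ler_piMl//; last by lra.
exact: mulr_ge0 (mulr_ge0 (@abs_slope_ge0 R) (ltW b_gt0)) t0.
Qed.

(** In the direction [e1] of the atom compare [q = e1^t G e1] with [b^2]. If
    [q < b^2], the atom is outside a slab that holds at most half of the normal
    mass; if [q > b^2], it is inside a slab whose complement holds at most half
    of it. If [q = b^2], the atom is on the boundary and counts on both sides,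
    so [e1] has to be tilted slightly towards [e2] or [- e2], with the sign that
    makes the cross term of the form nonnegative: this puts the atom strictly
    inside a slab whose half-width is asymptotically at least [b]. *)
Lemma dirac_depth_le e P G : 0 <= e <= 1 -> dirac_contaminated e P -> spd G ->
  (scatter_depth G P <= ((1 - e) / 2)%:E)%E.
Proof.
move=> e01 PE [GT Gpos].
have e1S : sphere e1 by rewrite sphereE.
have e20 : e2 != 0 by apply: sphere_neq0; rewrite sphereE.
have g1 := Gpos _ (sphere_neq0 e1S); have g2 := Gpos _ e20.
have e1E : e1 0 0 = 1 by rewrite mxE.
have b2_ge0 := sqr_ge0 b.
case: (ltgtP (qform G e1) (b ^+ 2)) => [qlt|qgt|qE].
- apply: le_trans (scatter_depth_le_inner G P e1S) _.
  rewrite PE; last exact: measurable_inner (ltW g1).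
  rewrite dirac_inner0 ?e1E ?mulr1// mule0 adde0.
  rewrite innerE ?(ltW g1)// std_normal_abs_in// EFinM -b_median.
  apply: lee_wpmul2l; first by rewrite lee_fin; lra.
  apply: le_abs_in; rewrite subitvE/= !bnd_simp.
  by rewrite -[leRHS](ger0_norm (ltW b_gt0)) -sqrtr_sqr ler_sqrt// ltW.
- apply: le_trans (scatter_depth_le_outer G P e1S) _.
  rewrite PE; last exact: measurable_outer (ltW g1).
  rewrite dirac_outer0 ?e1E ?mulr1// mule0 adde0.
  have := @le_half_outer e1 (qform G e1) e 0 e1S e01.
  rewrite !subr0 !mulr0 addr0 mulr1; apply; last exact: ltW.
  by rewrite lexx ltr01.
have [s [s2 sG]] : exists s : R, s ^+ 2 = 1 /\ 0 <= s * bform G e1 e2.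
  have [h|h] := leP 0 (bform G e1 e2).
    by exists 1; rewrite expr1n mul1r.
  by exists (-1); rewrite sqrrN expr1n mulN1r oppr_ge0 ltW.
have step (t : R) : 0 < t < 1 ->
    (scatter_depth G P <= ((1 - e) / 2 + abs_slope * b * t)%:E)%E.
  move=> /andP[t0 t1].
  (* the tilted direction, before normalization *)
  pose w := e1 + (s * t) *: e2.
  have w2 : qform 1%:M w = 1 + t ^+ 2.
    rewrite qform_scaleD ?trmx1// qform_e1 qform_e2 bform_e12 exprMn s2.
    by ring.
  have w2_gt0 : 0 < 1 + t ^+ 2 by rewrite ltr_pwDl// sqr_ge0.
  pose c := (Num.sqrt (1 + t ^+ 2))^-1.
  have c2 : c ^+ 2 = (1 + t ^+ 2)^-1 by rewrite exprVn sqr_sqrtr// ltW.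
  pose u := c *: w.
  have uS : sphere u by rewrite sphereE qformZ w2 c2 mulVf// gt_eqF.
  have u00 : u 0 0 = c by rewrite !mxE/=; ring.
  have quE : qform G u = (b ^+ 2 + 2 * t * (s * bform G e1 e2) + t ^+ 2 * qform G e2) / (1 + t ^+ 2).
    rewrite qformZ qform_scaleD// c2 qE exprMn s2; ring.
  have qu : b ^+ 2 / (1 + t ^+ 2) < qform G u.
    rewrite quE ltr_pM2r ?invr_gt0// -addrA ltrDl ltr_wpDl//.
      by apply: mulr_ge0 => //; lra.
    by rewrite mulr_gt0// exprn_gt0.
  have qu0 : 0 <= qform G u by apply: le_trans (ltW qu); rewrite divr_ge0// ltW.
  apply: le_trans (scatter_depth_le_outer G P uS) _.
  rewrite PE; last exact: measurable_outer.
  rewrite dirac_outer0 ?mule0 ?adde0; last by rewrite u00 exprMn c2.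
  apply: le_half_outer => //; first by rewrite (ltW t0).
  apply: le_trans (ltW qu); rewrite exprMn ler_wpM2l//.
  rewrite -[leRHS]mul1r ler_pdivlMr//.
  by nra.
apply/lee_addgt0Pr => d d0.
pose t := Num.min 2^-1 (d / (abs_slope * b + 1)).
have K1 : 0 < abs_slope * b + 1 by rewrite ltr_wpDl// mulr_ge0 ?abs_slope_ge0// ltW.
have tP : 0 < t < 1.
  rewrite /t lt_min gt_min divr_gt0// invr_gt0 ltr0n/=.
  by apply/orP; left; lra.
apply: le_trans (step t tP) _; rewrite -EFinD lee_fin lerD2l.
apply: (@le_trans _ _ ((abs_slope * b + 1) * t)).
  by rewrite ler_wpM2r//; [lra|rewrite lerDl].
by rewrite mulrC -ler_pdivlMr// /t ge_min lexx orbT.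
Qed.

(** The segment from [b^2 I] (at [a = 0]) to the rank one matrix of the atom
    (at [a = 1], excluded). *)
Definition flattened (a : R) : 'M[R]_n :=
  b ^+ 2 *: ((1 - a) *: 1%:M + a *: delta_mx 0 0).

Lemma qform_flattened a u :
  qform (flattened a) u = b ^+ 2 * ((1 - a) * qform 1%:M u + a * u 0 0 ^+ 2).
Proof.
have dE : (u^T *m delta_mx 0 0 *m u) 0 0 = u 0 0 ^+ 2.
  have -> : delta_mx 0 0 = e1 *m e1^T :> 'M[R]_n.
    by rewrite /e1 trmx_delta mul_delta_mx.
  rewrite mulmxA -mulmxA mxE big_ord1 -colE trmx_delta -rowE !mxE.
  by rewrite expr2.
rewrite /qform /flattened -scalemxAr -scalemxAl mxE; congr (_ * _).
rewrite mulmxDr mulmxDl -!scalemxAr -!scalemxAl [LHS]mxE.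
by congr (_ + _); rewrite mxE// dE.
Qed.

Lemma spd_flattened a : 0 <= a < 1 -> spd (flattened a).
Proof.
move=> /andP[a0 a1]; split.
  by rewrite /flattened !linearZ/= linearD/= !linearZ/= trmx1 trmx_delta.
move=> u u0; rewrite qform_flattened mulr_gt0 ?exprn_gt0//.
rewrite ltr_pwDl//; first by rewrite mulr_gt0 ?qform1_gt0// subr_gt0.
by rewrite mulr_ge0// sqr_ge0.
Qed.

(** The slab contains the atom, which alone weighs [e >= (1 - e) / 2], and is
    not wider than that of [b^2 I], whose complement has half of the normal
    mass. *)
Lemma flattened_depth_ge e P a : 3^-1 <= e < 1 -> dirac_contaminated e P ->
  0 <= a < 1 -> (((1 - e) / 2)%:E <= scatter_depth (flattened a) P)%E.
Proof.
move=> /andP[e3 e1'] PE /andP[a0 a1]; apply: scatter_depth_ge => u u1.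
have e01 : 0 <= e < 1 by apply/andP; split => //; lra.
have b2_ge0 := sqr_ge0 b.
have u00 : u 0 0 ^+ 2 <= 1.
  rewrite -[leRHS]u1 big_ord_recl lerDl; apply: sumr_ge0 => i _; exact: sqr_ge0.
have qE : qform (flattened a) u = b ^+ 2 * ((1 - a) + a * u 0 0 ^+ 2).
  by rewrite qform_flattened; move: u1; rewrite sphereE => ->; rewrite mulr1.
have qb : qform (flattened a) u <= b ^+ 2.
  rewrite qE -[leRHS]mulr1 ler_wpM2l//; nra.
have qx : (b * u 0 0) ^+ 2 <= qform (flattened a) u.
  rewrite qE exprMn ler_wpM2l//; nra.
have q0 := le_trans (sqr_ge0 _) qx.
split.
  rewrite PE; last exact: measurable_inner.
  rewrite dirac_inner1// mule1; apply: (@le_trans _ _ e%:E).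
    by rewrite lee_fin; lra.
  by rewrite leeDr// mule_ge0// lee_fin; lra.
apply: (half_le_contamination e01 (dirac_contaminatedW PE)).
  exact: measurable_outer.
rewrite outerE// std_normal_abs_in// -(normal_prob_abs_ge_median b_median).
apply: le_abs_in; rewrite subitvE/= !bnd_simp andbT.
by rewrite -(ger0_norm (ltW b_gt0)) -sqrtr_sqr ler_sqrt.
Qed.

Lemma qform_invmx_flattened a : 0 <= a < 1 ->
  qform (invmx (flattened a)) e2 = (b ^+ 2 * (1 - a))^-1.
Proof.
move=> a01; have Gu := spd_unitmx (spd_flattened a01).
case/andP: a01 => a0 a1.
have k0 : b ^+ 2 * (1 - a) != 0.
  by rewrite mulf_neq0 ?sqrf_eq0 ?gt_eqF// subr_gt0.
have Ge2 : flattened a *m e2 = (b ^+ 2 * (1 - a)) *: e2.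
  rewrite /flattened -scalemxAl mulmxDl -!scalemxAl mul1mx mul_delta_mx_0//.
  by rewrite scaler0 addr0 scalerA.
have iGe2 : invmx (flattened a) *m e2 = (b ^+ 2 * (1 - a))^-1 *: e2.
  by rewrite -[e2 in RHS](mulKmx Gu) Ge2 -scalemxAr scalerA mulVf// scale1r.
rewrite /qform -mulmxA iGe2 -scalemxAr mxE.
by move: qform_e2; rewrite /qform mulmx1 => ->; rewrite mulr1.
Qed.

Lemma deepest_flattened e P a : 3^-1 <= e < 1 -> dirac_contaminated e P ->
  0 <= a < 1 -> deepest P (flattened a).
Proof.
move=> e01 PE a01; split; first exact: spd_flattened.
move=> G Gspd; apply: le_trans (flattened_depth_ge e01 PE a01).
by apply: dirac_depth_le => //; case/andP: e01 => ? ?; apply/andP; split; lra.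
Qed.

(** N(0, I) is its own contamination of mass 0 by the atom, so that the bounds
    for contaminated laws cover the uncontaminated one. *)
Lemma deepest_std_normal : deepest P0 (flattened 0).
Proof.
have fE : flattened 0 = (b ^+ 2)%:M.
  by rewrite /flattened subr0 scale1r scale0r addr0 scalemx1.
split; first by apply: spd_flattened; rewrite lexx ltr01.
have e0 : 0 <= (0 : R) < 1 by rewrite lexx ltr01.
move=> G Gspd; rewrite fE.
apply: le_trans (scatter_depth_spherical_ge b_gt0 b_median e0 (@contamination0 _ _)).
apply: dirac_depth_le => //; first by rewrite lexx ler01.
by move=> A mA; rewrite subr0 mul1e mul0e adde0.
Qed.

(** The same contaminated law has all the flattened matrices as deepest ones,
    and their inverses are unbounded in the direction [e2]. *)
Lemma max_implosion_bias_third :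
  max_bias implosion_bias (3^-1 : R) P0 = +oo%E.
Proof.
have t0 : 0 <= (3^-1 : R) by rewrite invr_ge0.
have t1 : 0 <= 1 - (3^-1 : R) by lra.
pose P : probability (Rn R n) R := mixture P0 \d_atom t0 t1.
have PE : dirac_contaminated 3^-1 P by move=> A mA; exact: mixtureE.
have t3 : 3^-1 <= (3^-1 : R) < 1 by apply/andP; split; lra.
apply/eq_infty => r.
pose k := `|r| + 1.
have k1 : 1 <= k by rewrite /k lerDr.
have k0 : 0 < k by lra.
(* the bias of [flattened a] in the direction [e2] is [(1 - a)^-1 = k] *)
pose a := 1 - k^-1.
have a01 : 0 <= a < 1.
  apply/andP; split; first by rewrite subr_ge0 invf_le1.
  by rewrite gtrDl oppr_lt0 invr_gt0.
apply: (@le_trans _ _ (implosion_bias (flattened a) (flattened 0))).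
  apply: (@le_trans _ _ k%:E).
    by rewrite lee_fin /k; have := ler_norm r; lra.
  apply: le_ereal_sup_tmp; exists k%:E => //.
  exists e2; first by rewrite sphereE.
  rewrite !qform_invmx_flattened//; last by rewrite lexx ltr01.
  congr EFin; rewrite /a; field.
  by rewrite subKr oner_neq0 !gt_eqF.
apply: ereal_sup_ubound; exists P, (flattened a), (flattened 0); split; last by [].
- exact: dirac_contaminatedW.
- exact: (deepest_flattened t3 PE).
- exact: deepest_std_normal.
Qed.

End dirac_contamination.

Theorem theorem1 (R : realType) (p : nat) (hp : (2 <= p)%N) :
  mine (breakdown_point explosion_bias (std_normal p))
       (breakdown_point implosion_bias (std_normal p))
  = (3^-1 : R)%:E.
Proof.
case: p hp => [|[|p]]// _.
have [b [b0 bm]] := @normal_prob_abs_median R.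
apply/eqP; rewrite eq_le ge_min le_min; apply/andP; split.
  apply/orP; right; apply: ereal_inf_lbound; exists 3^-1 => //; split.
    by rewrite invr_gt0 ltr0n/= invf_lt1// ltr1n.
  exact: max_implosion_bias_third b0 bm.
by apply/andP; split; apply: breakdown_point_ge => e e3;
  have [] := @max_biases_lty R p.+2 e e3.
Qed.
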